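(* Let $H(q,p)$ be a hyperregular Hamiltonian on $T^*Q$ and let $L(q,\dot q)$ be the Lagrangian constructed from it by the Legendre transformation, $L(q,\dot q)=p\dot q-H(q,p)|_{\dot q=\partial H/\partial p}$. Let $\psi_1,\dots,\psi_s$ be basis functions on $[0,1]$ and let $(b_i,c_i)_{i=1}^s$ be a numerical quadrature formula. Then the generalized Galerkin Hamiltonian variational integrator $$q_1=q_0+h\sum_{i=1}^sB_iV^i,\qquad p_1=p_0-h\sum_{i=1}^sb_i\frac{\partial H}{\partial q}(Q^i,P^i),\qquad Q^i=q_0+h\sum_{j=1}^sA_{ij}V^j,$$ $$0=\sum_{i=1}^sb_iP^i\psi_j(c_i)-p_0B_j+h\sum_{i=1}^s(b_iB_j-b_iA_{ij})\frac{\partial H}{\partial q}(Q^i,P^i),\qquad 0=\sum_{i=1}^s\psi_i(c_j)V^i-\frac{\partial H}{\partial p}(Q^j,P^j),$$ ($i,j=1,\dots,s$) and the generalized Galerkin Lagrangian variational integrator $$q_1=q_0+h\sum_{i=1}^sB_iV^i,\qquad p_1=p_0+h\sum_{i=1}^sb_i\frac{\partial L}{\partial q}(Q^i,\dot Q^i),\qquad Q^i=q_0+h\sum_{j=1}^sA_{ij}V^j,$$ $$0=\sum_{i=1}^sb_i\frac{\partial L}{\partial\dot q}(Q^i,\dot Q^i)\psi_j(c_i)-p_0B_j-h\sum_{i=1}^s(b_iB_j-b_iA_{ij})\frac{\partial L}{\partial q}(Q^i,\dot Q^i),\qquad 0=\sum_{i=1}^s\psi_i(c_j)V^i-\dot Q^j,$$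 ($i,j=1,\dots,s$), associated with the same basis functions and quadrature formula, are equivalent: under the Legendre transformation $\dot Q^i=\frac{\partial H}{\partial p}(Q^i,P^i)$ (equivalently $P^i=\frac{\partial L}{\partial\dot q}(Q^i,\dot Q^i)$), $i=1,\dots,s$, the two systems of equations have the same solutions.
   Context: One works in canonical coordinates on $T^*Q$, with $Q$ an $n$-dimensional configuration manifold regarded as an open subset of $\mathbb{R}^n$. The Hamiltonian $H$ is hyperregular if the Legendre transformation $\mathbb{F}H:T^*Q\to TQ$, $(q,p)\mapsto(q,\partial H/\partial p(q,p))$, is a diffeomorphism. $h>0$ is the time step. $\psi_1,\dots,\psi_s$ are real-valued basis functions on $[0,1]$ of an $s$-dimensional function space. The quadrature formula is $\int_0^1f(x)\,dx\approx\sum_{i=1}^sb_if(c_i)$ with weights $b_i$ and points $c_i$. The coefficients are $B_i=\int_0^1\psi_i(\tau)\,d\tau$ and $A_{ij}=\int_0^{c_i}\psi_j(\tau)\,d\tau$. In each system the unknowns, besides $q_0,p_0,q_1,p_1$, are the coefficients $V^i$ and internal stages $Q^i$, together with $P^i$ (Hamiltonian version) or $\dot Q^i$ (Lagrangian version), all $n$-vectors. *)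

(* Defs.v *)
From HB Require Import structures.
From mathcomp Require Import all_boot all_order all_algebra.
From mathcomp Require Import all_classical all_reals all_analysis.

Set Implicit Arguments.
Unset Strict Implicit.
Unset Printing Implicit Defensive.
Import Order.TTheory GRing.Theory Num.Theory.
Import numFieldNormedType.Exports.
Local Open Scope classical_set_scope.
Local Open Scope ring_scope.

(* Since domains and codomains are finite dimensional below, continuity of all
   directional derivatives amounts to continuity of the differential. *)
Definition C1_on (R : realType) (V W : normedModType R) (U : set V)
    (f : V -> W) : Prop :=
  forall x, U x ->
    differentiable f x /\ forall v : V, {for x, continuous ('D_v f)}.

Definition diffeomorphism (R : realType) (V W : normedModType R)
    (U : set V) (U' : set W) (f : V -> W) : Prop :=
  C1_on U f /\ {homo f : x / U x >-> U' x} /\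
  exists g : W -> V, C1_on U' g /\ {homo g : y / U' y >-> U y} /\
    (forall x, U x -> g (f x) = x) /\ (forall y, U' y -> f (g y) = y).

(* For Q an open subset of R^n, both the tangent and the cotangent bundle of Q
   are Q x R^n; vectors and covectors are written as rows. *)
Definition bundle (R : realType) (n : nat) (Q : set 'rV[R]_n) :
    set ('rV[R]_n * 'rV[R]_n) :=
  Q `*` setT.

Definition partial1 (R : realType) (n : nat) (F : 'rV[R]_n * 'rV[R]_n -> R)
    (z : 'rV[R]_n * 'rV[R]_n) : 'rV[R]_n :=
  \row_(k < n) 'D_(delta_mx 0 k, 0) F z.

Definition partial2 (R : realType) (n : nat) (F : 'rV[R]_n * 'rV[R]_n -> R)
    (z : 'rV[R]_n * 'rV[R]_n) : 'rV[R]_n :=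
  \row_(k < n) 'D_(0, delta_mx 0 k) F z.

Definition pairing (R : realType) (n : nat) (p v : 'rV[R]_n) : R :=
  \sum_(k < n) p 0 k * v 0 k.

Definition legendre_transform (R : realType) (n : nat)
    (H : 'rV[R]_n * 'rV[R]_n -> R) (z : 'rV[R]_n * 'rV[R]_n) :
    'rV[R]_n * 'rV[R]_n :=
  (z.1, partial2 H z).

(* Only C^1 regularity is required, both of H and of the diffeomorphism, so
   that the smooth case is included. *)
Definition hyperregular (R : realType) (n : nat) (Q : set 'rV[R]_n)
    (H : 'rV[R]_n * 'rV[R]_n -> R) : Prop :=
  C1_on (bundle Q) H /\
  diffeomorphism (bundle Q) (bundle Q) (legendre_transform H).

(* L(q, v) = p v - H(q, p) where v = dH/dp(q, p).  When H is hyperregular this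
   determines L on the whole of TQ; its values outside TQ are irrelevant. *)
Definition legendre_lagrangian (R : realType) (n : nat) (Q : set 'rV[R]_n)
    (H L : 'rV[R]_n * 'rV[R]_n -> R) : Prop :=
  forall q v p, Q q -> v = partial2 H (q, p) ->
    L (q, v) = pairing p v - H (q, p).

(* psi_1, ..., psi_s are elements of L^1([0, 1]), linearly independent as
   functions on [0, 1]; their values outside [0, 1] are irrelevant. *)
Definition basis_functions (R : realType) (s : nat) (psi : 'I_s -> R -> R) :
    Prop :=
  (forall i, (@lebesgue_measure R).-integrable `[0, 1] (EFin \o psi i)) /\
  (forall a : 'I_s -> R,
     (forall t, t \in `[0, 1] -> \sum_(i < s) a i * psi i t = 0) ->
     forall i, a i = 0).

Definition coefB (R : realType) (s : nat) (psi : 'I_s -> R -> R)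
    (i : 'I_s) : R :=
  \int[lebesgue_measure]_(t in `[0, 1]) psi i t.

(* The set `[0, c i] gives the oriented integral because 0 <= c i. *)
Definition coefA (R : realType) (s : nat) (psi : 'I_s -> R -> R)
    (c : 'I_s -> R) (i j : 'I_s) : R :=
  \int[lebesgue_measure]_(t in `[0, c i]) psi j t.

(* (q0, p0, q1, p1, V, Qs, P) solves the generalized Galerkin Hamiltonian
   variational integrator; the positions q0, q1, Qs i are points of Q. *)
Definition galerkin_hamiltonian (R : realType) (n s : nat)
    (Q : set 'rV[R]_n) (H : 'rV[R]_n * 'rV[R]_n -> R)
    (psi : 'I_s -> R -> R) (b c : 'I_s -> R) (h : R)
    (q0 p0 q1 p1 : 'rV[R]_n) (V Qs P : 'I_s -> 'rV[R]_n) : Prop :=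
  let A := coefA psi c in
  let B := coefB psi in
  (Q q0 /\ Q q1 /\ forall i, Q (Qs i)) /\
  q1 = q0 + h *: (\sum_(i < s) B i *: V i) /\
  p1 = p0 - h *: (\sum_(i < s) b i *: partial1 H (Qs i, P i)) /\
  (forall i, Qs i = q0 + h *: (\sum_(j < s) A i j *: V j)) /\
  (forall j, 0 = \sum_(i < s) (b i * psi j (c i)) *: P i - B j *: p0
       + h *: (\sum_(i < s) (b i * B j - b i * A i j) *:
                 partial1 H (Qs i, P i))) /\
  (forall j, 0 = \sum_(i < s) psi i (c j) *: V i - partial2 H (Qs j, P j)).

(* (q0, p0, q1, p1, V, Qs, Qd) solves the generalized Galerkin Lagrangian
   variational integrator; Qd i is the velocity at the stage Qs i. *)
Definition galerkin_lagrangian (R : realType) (n s : nat)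
    (Q : set 'rV[R]_n) (L : 'rV[R]_n * 'rV[R]_n -> R)
    (psi : 'I_s -> R -> R) (b c : 'I_s -> R) (h : R)
    (q0 p0 q1 p1 : 'rV[R]_n) (V Qs Qd : 'I_s -> 'rV[R]_n) : Prop :=
  let A := coefA psi c in
  let B := coefB psi in
  (Q q0 /\ Q q1 /\ forall i, Q (Qs i)) /\
  q1 = q0 + h *: (\sum_(i < s) B i *: V i) /\
  p1 = p0 + h *: (\sum_(i < s) b i *: partial1 L (Qs i, Qd i)) /\
  (forall i, Qs i = q0 + h *: (\sum_(j < s) A i j *: V j)) /\
  (forall j, 0 = \sum_(i < s) (b i * psi j (c i)) *: partial2 L (Qs i, Qd i)
       - B j *: p0
       - h *: (\sum_(i < s) (b i * B j - b i * A i j) *: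
                 partial1 L (Qs i, Qd i))) /\
  (forall j, 0 = \sum_(i < s) psi i (c j) *: V i - Qd j).

(* Main.v *)
Require Import Defs.
From HB Require Import structures.
From mathcomp Require Import all_boot all_order all_algebra.
From mathcomp Require Import all_classical all_reals all_analysis.

Set Implicit Arguments.
Unset Strict Implicit.
Unset Printing Implicit Defensive.
Import Order.TTheory GRing.Theory Num.Theory.
Import numFieldNormedType.Exports.
Local Open Scope classical_set_scope.
Local Open Scope ring_scope.

(* Let g be the inverse of the Legendre transformation and write
   g(q, v) = (q, pi(q, v)).  On the open set TQ, L(q, v) = pi(q, v) v - H(g(q, v)),
   and in the differential of the right-hand side the two terms containing d pi
   cancel because dH/dp (g(q, v)) = v.  Hence dL/dv = pi and dL/dq = - dH/dq o g,
   and substituting these turns either integrator into the other. *)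

Lemma derive_linear_comp (R : realType) (U V W : normedModType R)
    (l : {linear V -> W}) (f : U -> V) (x w : U) :
  continuous l -> differentiable f x -> 'D_w (l \o f) x = l ('D_w f x).
Proof.
move=> cl df; have dl : differentiable l (f x) by exact: linear_differentiable.
rewrite !deriveE //; last exact: differentiable_comp.
by rewrite diff_comp // diff_lin.
Qed.

Lemma is_derive_coord (R : realType) (U : normedModType R) (m n : nat)
    (f : U -> 'M[R]_(m, n)) (x w : U) (i : 'I_m) (j : 'I_n) :
  differentiable f x ->
  is_derive x w (fun y => f y i j) ('D_w f x i j).
Proof.
move=> df; have dc := differentiable_coord (f x) i j.
apply: DeriveDef.
  exact/diff_derivable/(differentiable_comp df dc).
(* Taking an entry is a continuous linear map. Packed as such, it commutes with the derivative by
   [derive_linear_comp]. *)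
have lin : linear (fun N : 'M[R]_(m, n) => N i j) by move=> a A B; rewrite !mxE.
pose cM := GRing.isLinear.Build _ _ _ _ _ lin.
pose c : {linear 'M[R]_(m, n) -> R} := HB.pack (fun N : 'M[R]_(m, n) => N i j) cM.
have cc : continuous c by exact: coord_continuous.
exact: derive_linear_comp cc df.
Qed.

Lemma is_derive_pairing (R : realType) (U : normedModType R) (n : nat)
    (f g : U -> 'rV[R]_n) (x w : U) :
  differentiable f x -> differentiable g x ->
  is_derive x w (fun y => pairing (f y) (g y))
    (pairing ('D_w f x) (g x) + pairing (f x) ('D_w g x)).
Proof.
move=> df dg.
(* In the ring of functions the pairing is a sum of products, so the sum and product rules apply. *)
have -> : (fun y => pairing (f y) (g y)) =
    \sum_(k < n) ((fun y => f y 0 k) * (fun y => g y 0 k)).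
  by apply/funext => y; rewrite fct_sumE.
apply: is_derive_eq.
  apply: is_derive_sum => k.
  by apply: is_deriveM; exact: is_derive_coord.
rewrite /pairing -big_split /=; apply: eq_bigr => k _.
by rewrite addrC; congr (_ + _); rewrite [LHS]mulrC // mulrC.
Qed.

Lemma pairing0r (R : realType) (n : nat) (p : 'rV[R]_n) : pairing p 0 = 0.
Proof. by apply: big1 => k _; rewrite mxE mulr0. Qed.

Lemma pairing_delta (R : realType) (n : nat) (p : 'rV[R]_n) (k : 'I_n) :
  pairing p (delta_mx 0 k) = p 0 k.
Proof.
rewrite /pairing (bigD1 k) //= mxE !eqxx mulr1 big1 ?addr0 // => j jk.
by rewrite mxE (negbTE jk) mulr0.
Qed.

Lemma pairingC (R : realType) (n : nat) (p v : 'rV[R]_n) :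
  pairing p v = pairing v p.
Proof. by apply: eq_bigr => k _; rewrite mulrC. Qed.

(** Differentiability makes the directional derivative linear in [w], which is then expanded in the
    standard basis of the two factors. *)
Lemma derive_partials (R : realType) (n : nat)
    (F : 'rV[R]_n * 'rV[R]_n -> R) (z w : 'rV[R]_n * 'rV[R]_n) :
  differentiable F z ->
  'D_w F z = pairing (partial1 F z) w.1 + pairing (partial2 F z) w.2.
Proof.
move=> dF; rewrite deriveE //.
have {1}-> : w = \sum_(k < n) w.1 0 k *: ((delta_mx 0 k, 0) : 'rV[R]_n * 'rV[R]_n)
  + \sum_(k < n) w.2 0 k *: ((0, delta_mx 0 k) : 'rV[R]_n * 'rV[R]_n).
  rewrite [LHS]surjective_pairing [RHS]surjective_pairing /=.
  congr pair; rewrite /= !raddf_sum /=.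
    rewrite [X in _ + X]big1 ?addr0; last by move=> k _; rewrite scaler0.
    exact: row_sum_delta.
  rewrite [X in X + _]big1 ?add0r; last by move=> k _; rewrite scaler0.
  exact: row_sum_delta.
rewrite linearD !linear_sum /pairing; congr (_ + _); apply: eq_bigr => k _;
  by rewrite linearZ /= mxE deriveE // mulrC.
Qed.

Lemma open_bundle (R : realType) (n : nat) (Q : set 'rV[R]_n) :
  open Q -> open (bundle Q).
Proof.
have -> : bundle Q = fst @^-1` Q.
  by apply/seteqP; split => z /=; [case|split].
by move=> oQ; apply: open_comp => // z _; exact: cvg_fst.
Qed.

Lemma derive_legendre_lagrangian (R : realType) (n : nat) (Q : set 'rV[R]_n)
    (H L : 'rV[R]_n * 'rV[R]_n -> R)
    (g : 'rV[R]_n * 'rV[R]_n -> 'rV[R]_n * 'rV[R]_n)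
    (z w : 'rV[R]_n * 'rV[R]_n) :
  open Q -> legendre_lagrangian Q H L ->
  (forall y, bundle Q y -> legendre_transform H (g y) = y) ->
  bundle Q z -> differentiable g z -> differentiable H (g z) ->
  'D_w L z = pairing (g z).2 w.2 - pairing (partial1 H (g z)) w.1.
Proof.
move=> oQ HL gK Qz dg dH.
have g1 y : bundle Q y -> (g y).1 = y.1 by move=> /gK /(congr1 fst).
have g2 y : bundle Q y -> partial2 H (g y) = y.2 by move=> /gK /(congr1 snd).
have nQ : \forall y \near z, bundle Q y.
  by apply: open_nbhs_nbhs; split=> //; exact: open_bundle.
have cfst : continuous (fst : 'rV[R]_n * 'rV[R]_n -> _).
  by move=> y; exact: cvg_fst.
have csnd : continuous (snd : 'rV[R]_n * 'rV[R]_n -> _).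
  by move=> y; exact: cvg_snd.
have dsnd : differentiable (snd : 'rV[R]_n * 'rV[R]_n -> _) z.
  exact: linear_differentiable.
have dpi : differentiable (snd \o g) z.
  by apply: differentiable_comp => //; exact: linear_differentiable.
(* The Legendre transformation fixes base points, so [fst \o g] agrees with [fst] near [z] and has
   the same derivative. *)
have Dg1 : ('D_w g z).1 = w.1.
  rewrite -(derive_linear_comp w cfst dg).
  rewrite (@near_eq_derive _ _ _ _ fst).
    by rewrite deriveE ?diff_lin //; exact: linear_differentiable.
  by apply: filterS nQ => y /g1.
have Dg2 : ('D_w g z).2 = 'D_w (snd \o g) z.
  by rewrite (derive_linear_comp w csnd dg).
(* [L] is prescribed only on TQ. Since TQ is open, the formula with momentum [(g y).2] holds in a
   neighbourhood of [z], which suffices for the derivative. *)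
have -> : 'D_w L z = 'D_w ((fun y => pairing ((snd \o g) y) y.2) - (H \o g)) z.
  apply: near_eq_derive; apply: filterS nQ => y Qy.
  have yE : (y.1, (g y).2) = g y by rewrite -g1 // -surjective_pairing.
  rewrite [in LHS](surjective_pairing y) (HL _ _ (g y).2) ?yE ?g2 //.
  by case: Qy.
have Dsnd : 'D_w snd z = w.2 by rewrite deriveE // diff_lin.
have iP := is_derive_pairing w dpi dsnd.
have dHg : differentiable (H \o g) z by exact: differentiable_comp.
rewrite deriveB; [|exact: ex_derive|exact: diff_derivable].
rewrite derive_val (deriveE _ dHg) diff_comp //=.
rewrite -(deriveE _ dg) -(deriveE _ dH).
(* The chain rule for [H \o g] contributes the pairing of [z.2] with the derivative of [snd \o g];
   the product rule gives the same term, and the two cancel. *)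
rewrite derive_partials // Dg1 Dg2 Dsnd g2 // [pairing z.2 _]pairingC.
by rewrite opprD addrA addrC !addrA addNr add0r.
Qed.

(** The inverse diffeomorphism also preserves base points, so its value at [(q, v)] lies over [q]
    and its second component is the required momentum. *)
Lemma legendre_surjective (R : realType) (n : nat) (Q : set 'rV[R]_n)
    (H : 'rV[R]_n * 'rV[R]_n -> R) (q v : 'rV[R]_n) :
  hyperregular Q H -> Q q -> exists p, v = partial2 H (q, p).
Proof.
case=> _ [_ [_ [g [_ [_ [_ gK]]]]]] Qq; exists (g (q, v)).2.
have /gK gqv : bundle Q (q, v) by [].
have g1 : (g (q, v)).1 = q by have := congr1 fst gqv.
have -> : (q, (g (q, v)).2) = g (q, v) by rewrite -{1}g1 -surjective_pairing.
by have := congr1 snd gqv.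
Qed.

Lemma partials_legendre_lagrangian (R : realType) (n : nat) (Q : set 'rV[R]_n)
    (H L : 'rV[R]_n * 'rV[R]_n -> R) (q p v : 'rV[R]_n) :
  open Q -> hyperregular Q H -> legendre_lagrangian Q H L ->
  Q q -> v = partial2 H (q, p) ->
  partial1 L (q, v) = - partial1 H (q, p) /\ partial2 L (q, v) = p.
Proof.
move=> oQ [C1H [_ [_ [g [C1g [_ [fK gK]]]]]]] HL Qq vE.
have Qqp : bundle Q (q, p) by [].
have Qqv : bundle Q (q, v) by [].
have gE : g (q, v) = (q, p) by rewrite vE; exact: (fK (q, p)).
have dg : differentiable g (q, v) by case: (C1g _ Qqv).
have dH : differentiable H (g (q, v)) by rewrite gE; case: (C1H _ Qqp).
have DL w := derive_legendre_lagrangian w oQ HL gK Qqv dg dH.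
(* A basis direction in one factor has zero component in the other, so just one of the two pairings
   survives and reduces to a coordinate. *)
by split; apply/rowP => k; rewrite !mxE DL gE /= pairing0r pairing_delta
  ?sub0r ?subr0 ?mxE.
Qed.

Theorem proposition2 (R : realType) (n s : nat) (Q : set 'rV[R]_n)
    (H L : 'rV[R]_n * 'rV[R]_n -> R) (psi : 'I_s -> R -> R)
    (b c : 'I_s -> R) (h : R)
    (openQ : open Q) (Hreg : hyperregular Q H)
    (HL : legendre_lagrangian Q H L)
    (psi_basis : basis_functions psi)
    (c01 : forall i, 0 <= c i <= 1) (h_gt0 : 0 < h) :
  (forall q p v : 'rV[R]_n, Q q ->
     (v = partial2 H (q, p) <-> p = partial2 L (q, v))) /\
  (forall (q0 p0 q1 p1 : 'rV[R]_n) (V Qs P Qd : 'I_s -> 'rV[R]_n),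
     (forall i, Qd i = partial2 H (Qs i, P i)) ->
     (galerkin_hamiltonian Q H psi b c h q0 p0 q1 p1 V Qs P <->
      galerkin_lagrangian Q L psi b c h q0 p0 q1 p1 V Qs Qd)) /\
  (forall (q0 p0 q1 p1 : 'rV[R]_n) (V Qs P : 'I_s -> 'rV[R]_n),
     galerkin_hamiltonian Q H psi b c h q0 p0 q1 p1 V Qs P ->
     exists2 Qd : 'I_s -> 'rV[R]_n,
       forall i, Qd i = partial2 H (Qs i, P i) &
       galerkin_lagrangian Q L psi b c h q0 p0 q1 p1 V Qs Qd) /\
  (forall (q0 p0 q1 p1 : 'rV[R]_n) (V Qs Qd : 'I_s -> 'rV[R]_n),
     galerkin_lagrangian Q L psi b c h q0 p0 q1 p1 V Qs Qd ->
     exists2 P : 'I_s -> 'rV[R]_n,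
       forall i, P i = partial2 L (Qs i, Qd i) &
       galerkin_hamiltonian Q H psi b c h q0 p0 q1 p1 V Qs P).
Proof.
have dLP q p v (Qq : Q q) :=
  @partials_legendre_lagrangian R n Q H L q p v openQ Hreg HL Qq.
have legendreP q p v : Q q -> (v = partial2 H (q, p) <-> p = partial2 L (q, v)).
  move=> Qq; split=> [/dLP[]//|].
  (* The velocity [v] comes from some momentum [p']; the direct implication gives dL/dv = [p'],
     which forces [p = p']. *)
  have [p' vE] := legendre_surjective v Hreg Qq.
  by have [_ ->] := dLP _ _ _ Qq vE => ->.
have equiv q0 p0 q1 p1 V Qs P Qd :
    (forall i, Qd i = partial2 H (Qs i, P i)) ->
    (galerkin_hamiltonian Q H psi b c h q0 p0 q1 p1 V Qs P <->
     galerkin_lagrangian Q L psi b c h q0 p0 q1 p1 V Qs Qd).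
  move=> QdE; rewrite /galerkin_hamiltonian /galerkin_lagrangian /=.
  (* The formulas for the partials of [L] hold only over [Q]; if some stage leaves [Q], neither
     system is satisfied. *)
  have [QQs|nQs] := pselect (forall i, Q (Qs i)); last first.
    by split=> -[[_ [_ /nQs]]].
  have dL1 i : partial1 L (Qs i, Qd i) = - partial1 H (Qs i, P i).
    by have [] := dLP _ _ _ (QQs i) (QdE i).
  have dL2 i : partial2 L (Qs i, Qd i) = P i.
    by have [] := dLP _ _ _ (QQs i) (QdE i).
  (* Otherwise unification keeps unfolding the derivatives and integrals. *)
  move: QdE dL1 dL2; move: (Defs.coefA psi c) (Defs.coefB psi) => A B.
  move: (partial1 H) (partial2 H) (partial1 L) (partial2 L).
  move=> H1 H2 L1 L2 QdE dL1 dL2.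
  have sumN (a : 'I_s -> R) : \sum_(i < s) a i *: L1 (Qs i, Qd i) =
      - \sum_(i < s) a i *: H1 (Qs i, P i).
    by rewrite -sumrN; apply: eq_bigr => i _; rewrite dL1 scalerN.
  have sum2 (a : 'I_s -> R) : \sum_(i < s) a i *: L2 (Qs i, Qd i) =
      \sum_(i < s) a i *: P i by apply: eq_bigr => i _; rewrite dL2.
  rewrite sumN scalerN.
  (* The sign change has made the two equations for [p1] identical, so only the momentum and
     velocity conditions at the stages remain. *)
  split=> -[? [? [? [? [stageP stageV]]]]]; do 4![split=> //]; split=> j.
  - by rewrite sum2 sumN scalerN opprK; exact: stageP.
  - by rewrite QdE; exact: stageV.
  - by have := stageP j; rewrite sum2 sumN scalerN opprK.
  - by rewrite -QdE; exact: stageV.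
split=> //; split=> //; split=> q0 p0 q1 p1 V Qs.
  move=> P solH; exists (fun i => partial2 H (Qs i, P i)) => //.
  by have [/(_ solH)] := equiv q0 p0 q1 p1 V Qs P _ (fun=> erefl).
move=> Qd solL; exists (fun i => partial2 L (Qs i, Qd i)) => //.
(* A solution has its stages in [Q], so [legendreP] inverts the choice of momenta and recovers [Qd],
   as [equiv] requires. *)
have QdE i : Qd i = partial2 H (Qs i, partial2 L (Qs i, Qd i)).
  by apply/legendreP => //; case: solL => -[_ []].
by have [_ /(_ solL)] := equiv q0 p0 q1 p1 V Qs _ _ QdE.
Qed.
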